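(* (i) For every $L>0$, the map $\Delta\mapsto \mathrm P_\Delta(|\hat\tau_{\rm PT}-\tau|\le L(1+\gamma)^{-1/2}\sigma_0)$ is symmetric about $\Delta=0$. (ii) For every $t\in\mathbb R$ and $L\ge0$, with $c=c_{\alpha/2}$, \begin{align*} G_{\rm PT}(t,L):={}&\mathrm P_{\Delta/\sigma_0=t}\big(|\hat\tau_{\rm PT}-\tau|\le L(1+\gamma)^{-1/2}\sigma_0\big)\\ ={}&\Big[\Phi\big(c-\sqrt{\tfrac{\gamma}{1+\gamma}}t\big)-\Phi\big(-c-\sqrt{\tfrac{\gamma}{1+\gamma}}t\big)\Big]\Big[\Phi\big(L-\tfrac{\gamma}{\sqrt{1+\gamma}}t\big)-\Phi\big(-L-\tfrac{\gamma}{\sqrt{1+\gamma}}t\big)\Big]\\ &+\int_{-\infty}^{-c-\sqrt{\frac{\gamma}{1+\gamma}}t}\big[\Phi(L+\sqrt\gamma u)-\Phi(-L+\sqrt\gamma u)\big]\phi(u)\,du\\ &+\int_{c-\sqrt{\frac{\gamma}{1+\gamma}}t}^{\infty}\big[\Phi(L+\sqrt\gamma u)-\Phi(-L+\sqrt\gamma u)\big]\phi(u)\,du. \end{align*} (iii) Fix $b\ge0$ and $\zeta\in(0,1)$, and let \[ \hat L_{\rm PT}=\inf\Big\{L\ge0:\inf_{\Delta:|\Delta/\sigma_0|\le b}\mathrm P_\Delta\big(|\hat\tau_{\rm PT}-\tau|\le L(1+\gamma)^{-1/2}\sigma_0\big)\ge 1-\zeta\Big\}. \] Then $\hat L_{\rm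 PT}$ is the solution in $L$ of $\min_{0\le t\le b}G_{\rm PT}(t,L)=1-\zeta$. Hence $[\hat\tau_{\rm PT}\pm \hat L_{\rm PT}(1+\gamma)^{-1/2}\sigma_0]$ is the shortest symmetric interval centered at $\hat\tau_{\rm PT}$, with data-independent half-length, having coverage at least $1-\zeta$ uniformly over $|\Delta/\sigma_0|\le b$.
   Context: Let $\tau\in\mathbb R$ be an unknown parameter and $\Delta\in\mathbb R$ an unknown bias. Let $\sigma_0,\sigma_1>0$ be known. We observe independent random variables $\hat\tau_0\sim N(\tau,\sigma_0^2)$ and $\hat\tau_1\sim N(\tau+\Delta,\sigma_1^2)$. Define $\gamma=\sigma_0^2/\sigma_1^2$ and $\sigma=\sqrt{\sigma_0^2+\sigma_1^2}$. Write $\Phi$ and $\phi$ for the standard normal CDF and density. For $a\in(0,1)$, let $c_a=\Phi^{-1}(1-a)$. Fix a tuning level $\alpha\in(0,1)$. The pretest estimator is \[ \hat\tau_{\rm PT}=\hat\tau_0+\frac{\gamma}{1+\gamma}(\hat\tau_1-\hat\tau_0)\,\mathbf 1\big(|\hat\tau_1-\hat\tau_0|\le \sigma c_{\alpha/2}\big). \] $\mathrm P_\Delta$ denotes probability under bias $\Delta$, and $\mathrm P_{\Delta/\sigma_0=t}$ means probability under $\Delta=t\sigma_0$. These probabilities do not depend on $\tau$. *)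

(* Defs.v *)
From HB Require Import structures.
From mathcomp Require Import all_boot all_order all_algebra.
From mathcomp Require Import all_classical all_reals all_analysis.
Set Implicit Arguments. Unset Strict Implicit. Unset Printing Implicit Defensive.
Import Order.TTheory GRing.Theory Num.Theory.
Import numFieldNormedType.Exports.
Local Open Scope classical_set_scope.
Local Open Scope ring_scope.

Section defs.
Context {R : realType}.

Definition phi (x : R) : R := normal_pdf 0 1 x.
Definition Phi (x : R) : R := fine (normal_prob 0 1 `]-oo, x]).

Definition gam (s0 s1 : R) : R := s0 ^+ 2 / s1 ^+ 2.
Definition sig (s0 s1 : R) : R := Num.sqrt (s0 ^+ 2 + s1 ^+ 2).

(* the pretest estimator as a function of the observations (x0, x1) = (tau0hat, tau1hat);
   c is the critical value c_{alpha/2} *)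
Definition tauPT (s0 s1 c x0 x1 : R) : R :=
  x0 + gam s0 s1 / (1 + gam s0 s1) * (x1 - x0)
       * (if `|x1 - x0| <= sig s0 s1 * c then 1 else 0).

(* P_Delta(|tauPT - tau| <= L (1+gamma)^{-1/2} s0), where
   tau0hat ~ N(tau, s0^2) and tau1hat ~ N(tau + Delta, s1^2) are independent
   (joint law = product of the two normal laws). *)
Definition covprob (tau Delta s0 s1 c L : R) : \bar R :=
  ((normal_prob tau s0 \x normal_prob (tau + Delta) s1)
     [set x : R * R | `|tauPT s0 s1 c x.1 x.2 - tau|
                        <= L * (Num.sqrt (1 + gam s0 s1))^-1 * s0]%R)%E.

Definition GPT (tau s0 s1 c t L : R) : \bar R := covprob tau (t * s0) s0 s1 c L.

Definition GPT_formula (s0 s1 c t L : R) : \bar R :=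
  let g := gam s0 s1 in
  let a := Num.sqrt (g / (1 + g)) in
  let k := g / Num.sqrt (1 + g) in
  let h := fun u : R => (Phi (L + Num.sqrt g * u) - Phi (- L + Num.sqrt g * u)) * phi u in
  (((Phi (c - a * t) - Phi (- c - a * t)) * (Phi (L - k * t) - Phi (- L - k * t)))%:E
   + (\int[lebesgue_measure]_(u in `]-oo, (- c - a * t)%R]) (h u)%:E)
   + (\int[lebesgue_measure]_(u in `[(c - a * t)%R, +oo[) (h u)%:E))%E.

Definition LPT (tau s0 s1 c b zeta : R) : R :=
  inf [set L : R | 0 <= L /\
        ((1 - zeta)%:E <= ereal_inf [set covprob tau D s0 s1 c L
                                      | D in [set D : R | `|D / s0| <= b]%R])%E].

Definition minG_eq (tau s0 s1 c b L v : R) : Prop :=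
  (exists2 t : R, 0 <= t <= b & GPT tau s0 s1 c t L = v%:E) /\
  (forall t : R, 0 <= t <= b -> (v%:E <= GPT tau s0 s1 c t L)%E).

End defs.

(* Main.v *)
Require Import Defs.
From HB Require Import structures.
From mathcomp Require Import all_boot all_order all_algebra.
From mathcomp Require Import all_classical all_reals all_analysis.
From mathcomp Require Import measurable_realfun ring lra.
Import Order.TTheory GRing.Theory Num.Theory.
Import numFieldNormedType.Exports.
Local Open Scope classical_set_scope.
Local Open Scope ring_scope.

(* A rotation of the observation plane turns the two independent normals into
   independent standard normals: U, the standardized difference tau1hat - tau0hat,
   and W, the standardized error of the precision-weighted average.  In these
   coordinates the rotation is the composition of two shears, so that Tonelli and
   affine substitutions on the line suffice.  The pretest only looks at U, and
   given U = u the coverage event confines W to an interval.  Hence the coverage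
   probability is the integral of [condcov] against the standard normal density:
   splitting it at the critical values gives the closed form (ii), and the symmetry
   of [condcov] under (t, u) -> (-t, -u) gives (i).  For (iii), the coverage is
   strictly increasing and Lipschitz in L, uniformly in t, continuous in t, and, as
   the pretest moves the estimator by a bounded amount, it tends to 1 uniformly in t
   when L grows; so the infimum defining hat L_PT is attained and is the unique root. *)

(** * Affine substitution and integration against normal laws *)

Section lebesgue_affine.
Context {R : realType}.
Local Notation mu := (@lebesgue_measure R).
Local Open Scope ereal_scope.

Lemma preimage_affine_itvoc (a b x y : R) : (0 < a)%R ->
  (fun z : R => a * z + b)%R @^-1` `]x, y]%classic = `](x - b) / a, (y - b) / a]%classic%R.
Proof.
move=> a0; apply/seteqP; split => z /=; rewrite !in_itv/=;
  by rewrite ltr_pdivrMr// ler_pdivlMr// ltrBlDr lerBrDr mulrC.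
Qed.

Lemma measurable_affine (a b : R) :
  measurable_fun [set: R] (fun z : R => a * z + b)%R.
Proof. by apply: measurable_funD => //; exact: measurable_funM. Qed.

(** Lebesgue measure is [a] times its own image under [z |-> a * z + b]; by uniqueness of Lebesgue
    measure this need only be checked on the intervals []x, y]]. *)
Lemma ge0_integral_affine (f : R -> \bar R) (a b : R) : (0 < a)%R ->
  measurable_fun [set: R] f -> (forall x, 0 <= f x) ->
  \int[mu]_x f x = a%:E * \int[mu]_x f (a * x + b)%R.
Proof.
move=> a0 mf f0; pose F (z : R) := (a * z + b)%R.
have mF : measurable_fun [set: measurableTypeR R] (F : _ -> measurableTypeR R).
  exact: measurable_affine.
pose aN : {nonneg R} := NngNum (ltW a0).
pose nu : {measure set (measurableTypeR R) -> \bar R} :=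
  measure_function_pushforward__canonical__measure_function_Measure mu mF.
transitivity (\int[mscale aN nu]_x f x).
  apply: eq_measure_integral => A mA _.
  apply: lebesgue_measure_unique => //= _ [[x y]] _ <- /=.
  rewrite /mscale/= /pushforward preimage_affine_itvoc// !lebesgue_measure_itv/=.
  rewrite !lte_fin ltr_pM2r ?invr_gt0// ltrD2r.
  case: ifPn => _; last by rewrite mule0.
  rewrite -!EFinD -EFinM; congr EFin.
  by field; rewrite gt_eqF.
rewrite ge0_integral_mscale//= ge0_integral_pushforward//=.
Qed.

Lemma ge0_integral_opp (D : set R) (f : R -> \bar R) : measurable D ->
  measurable_fun [set: R] f -> (forall x, 0 <= f x) ->
  \int[mu]_(x in D) f x = \int[mu]_(x in -%R @^-1` D) f (- x)%R.
Proof.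
move=> mD mf f0.
rewrite -[RHS](@ge0_integral_pushforward _ _ _ _ R
  (-%R : measurableTypeR R -> measurableTypeR R) _ mu D f)//=; last first.
  exact: measurable_funTS.
by apply: eq_measure_integral => A mA _; exact/esym/lebesgue_measureN.
Qed.

Lemma ge0_muleintegral (k : \bar R) (f : R -> \bar R) :
  measurable_fun [set: R] f -> (forall x, 0 <= f x) -> 0 <= k ->
  k * \int[mu]_x f x = \int[mu]_x (k * f x).
Proof. by move=> mf f0 k0; rewrite ge0_integralZl. Qed.

End lebesgue_affine.

Section normal_prob_integral.
Context {R : realType}.
Local Notation mu := (@lebesgue_measure R).
Local Open Scope ereal_scope.

(** The Radon-Nikodym derivative of the normal law is almost everywhere [normal_pdf], since both
    have the same integral over every measurable set. *)
Lemma integral_normal_prob (m s : R) (f : R -> \bar R) :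
  measurable_fun [set: R] f ->
  \int[normal_prob m s]_x `|f x| < +oo ->
  \int[normal_prob m s]_x f x = \int[mu]_x (f x * (normal_pdf m s x)%:E).
Proof.
move=> mf finf.
rewrite -(Radon_Nikodym_change_of_variables (normal_prob_dominates m s))//=;
  last by apply/integrableP; split.
apply: ae_eq_integral => //.
- apply: emeasurable_funM => //; apply: (measurable_int mu).
  by apply: Radon_Nikodym_integrable; exact: normal_prob_dominates.
- apply: emeasurable_funM => //=; apply/measurableT_comp => //=.
  exact: measurable_normal_pdf.
- apply: ae_eqe_mul2l => /=.
  rewrite Radon_NikodymE//=; first exact: normal_prob_dominates.
  move=> dom; case: cid => /= h [h1 h2 h3].
  apply: integral_ae_eq => //=.
  + by apply/measurableT_comp =>//; exact: measurable_normal_pdf.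
  + by move=> E _ mE; rewrite -h3.
Qed.

Lemma normal_prob_indic (m s : R) (B : set R) :
  normal_prob m s B = \int[mu]_y (\1_B y * normal_pdf m s y)%:E.
Proof.
rewrite /normal_prob integral_mkcond; apply: eq_integral => y _.
by rewrite patchE indicE; case: ifPn => _; rewrite ?mul1r ?mul0r.
Qed.

End normal_prob_integral.

(** * Rotation of a product of normal laws *)

Section normal_rotation.
Context {R : realType}.
Local Notation mu := (@lebesgue_measure R).
Implicit Types (m s x y u w : R).

(** The standardized deviations are [(s1 * w - s0 * u) / S] and [(s0 * w + s1 * u) / S], a rotation
    of [(w, u)], so the sum of squares in the exponent is preserved. The Jacobian [s0 * s1 / S * S]
    stays a product of the factors of two successive substitutions. *)
Lemma normal_pdf_rotation (m0 m1 s0 s1 u w : R) : 0 < s0 -> 0 < s1 ->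
  let S := Num.sqrt (s0 ^+ 2 + s1 ^+ 2) in
  s0 * s1 / S * S * (normal_pdf m1 s1 (s0 * s1 / S * w + (m1 + s1 ^+ 2 / S * u)) *
    normal_pdf m0 s0 (s0 * s1 / S * w + (m0 - s0 ^+ 2 / S * u))) =
  normal_pdf 0 1 w * normal_pdf 0 1 u.
Proof.
move=> s00 s10 S.
have S0 : 0 < S by rewrite sqrtr_gt0 addr_gt0// exprn_gt0.
have SE : S ^+ 2 = s0 ^+ 2 + s1 ^+ 2 by rewrite sqr_sqrtr// ltW// addr_gt0// exprn_gt0.
have [s0N s1N SN] : [/\ s0 != 0, s1 != 0 & S != 0] by rewrite !gt_eqF.
rewrite !normal_pdfE ?oner_eq0// /normal_peak /normal_fun.
have peakE (s : R) : 0 < s -> (Num.sqrt (s ^+ 2 * pi *+ 2))^-1 =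
    s^-1 * (Num.sqrt (pi *+ 2))^-1.
  move=> s_gt0; rewrite -mulrnAr sqrtrM ?sqr_ge0// sqrtr_sqr gtr0_norm// invfM.
  by [].
rewrite !peakE// invr1 mul1r.
set p := (Num.sqrt (pi *+ 2))^-1.
transitivity (p * p * (expR (- (s0 * s1 / S * w + (m1 + s1 ^+ 2 / S * u) - m1) ^+ 2 / (s1 ^+ 2 *+ 2)) * expR (- (s0 * s1 / S * w + (m0 - s0 ^+ 2 / S * u) - m0) ^+ 2 / (s0 ^+ 2 *+ 2)))).
  field; by rewrite SN s0N s1N.
rewrite [RHS]mulrACA -!expRD; congr (_ * expR _).
rewrite !subr0 expr1n.
transitivity (- (w ^+ 2 + u ^+ 2) * (s0 ^+ 2 + s1 ^+ 2) / (S ^+ 2) / 2).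
  field; by rewrite SN s0N s1N.
by rewrite -SE; field.
Qed.

Local Open Scope ereal_scope.

Lemma normal_product_rotation (m0 m1 s0 s1 : R) (A : set (R * R)) :
  (0 < s0)%R -> (0 < s1)%R -> measurable A ->
  let S := Num.sqrt (s0 ^+ 2 + s1 ^+ 2)%R in
  (normal_prob m0 s0 \x normal_prob m1 s1) A =
  \int[mu]_u (normal_prob 0 1
     [set w | A ((s0 * s1 / S * w + (m0 - s0 ^+ 2 / S * u))%R,
                 (s0 * s1 / S * w + (m1 + s1 ^+ 2 / S * u))%R)] * (phi u)%:E).
Proof.
move=> s00 s10 mA S.
have S0 : (0 < S)%R by rewrite sqrtr_gt0 addr_gt0// exprn_gt0.
have SE : (S ^+ 2 = s0 ^+ 2 + s1 ^+ 2)%R by rewrite sqr_sqrtr// ltW// addr_gt0// exprn_gt0.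
have [s0N s1N SN] : [/\ s0 != 0, s1 != 0 & S != 0]%R by rewrite !gt_eqF.
set r := (s0 * s1 / S)%R.
have r0 : (0 < r)%R by rewrite divr_gt0// mulr_gt0.
pose F (z : R * R) : \bar R := (\1_A z * (normal_pdf m1 s1 z.2 * normal_pdf m0 s0 z.1))%:E.
have mpdf m s : measurable_fun [set: R] (normal_pdf m s) by exact: measurable_normal_pdf.
have mF : measurable_fun [set: R * R] F.
  apply/measurable_EFinP; apply: measurable_funM; first exact: measurable_indic.
  by apply: measurable_funM; exact: measurableT_comp.
have F0 z : 0 <= F z by rewrite lee_fin !mulr_ge0// normal_pdf_ge0.
transitivity (\int[mu]_x \int[mu]_y F (x, y)).
  rewrite /product_measure1 integral_normal_prob; last 2 first.
  - exact: measurable_fun_xsection.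
  - apply: (@le_lt_trans _ _ (\int[normal_prob m0 s0]_x 1)); last first.
      by rewrite integral_cst//= probability_setT mule1 ltry.
    apply: ge0_le_integral => //=.
    + by apply: measurableT_comp => //; exact: measurable_fun_xsection.
    + by move=> x _; rewrite gee0_abs// probability_le1//; exact: measurable_xsection.
  apply: eq_integral => x _ /=.
  rewrite normal_prob_indic.
  rewrite muleC ge0_muleintegral; last 3 first.
  - apply/measurable_EFinP; apply: measurable_funM; last exact: mpdf.
    by apply: measurable_indic; exact: measurable_xsection.
  - by move=> y; rewrite lee_fin mulr_ge0// normal_pdf_ge0.
  - by rewrite lee_fin normal_pdf_ge0.
  apply: eq_integral => y _; rewrite /F/= -EFinM; congr EFin.
  by rewrite !indicE mem_xsection mulrC mulrA.
(* First shear: with [x] fixed, [y = S * u + (x + (m1 - m0))], so [u] standardizes the difference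
   [y - x]. *)
pose G (z : R * R) : \bar R := S%:E * F (z.1, S * z.2 + (z.1 + (m1 - m0)))%R.
have mfst : measurable_fun [set: R * R] (fun z : R * R => z.1) by exact: measurable_fst.
have msnd : measurable_fun [set: R * R] (fun z : R * R => z.2) by exact: measurable_snd.
have mG : measurable_fun [set: R * R] G.
  apply: emeasurable_funM => //; apply: measurableT_comp => //.
  apply/measurable_fun_pairP; split => //=.
  apply: measurable_funD; first exact: measurable_funM.
  exact: measurable_funD.
have G0 z : 0 <= G z by rewrite mule_ge0// lee_fin ltW.
transitivity (\int[mu]_x \int[mu]_u G (x, u)).
  apply: eq_integral => x _; have mFx : measurable_fun [set: R] (fun y => F (x, y)).
    by apply: measurableT_comp => //; exact: pair1_measurable.
  rewrite (ge0_integral_affine _ _ (x + (m1 - m0)) S0)//.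
  rewrite ge0_muleintegral//; last by rewrite lee_fin ltW.
  by apply: measurableT_comp mFx _; exact: measurable_affine.
(* Second shear: after the exchange of integrals [u] is fixed, and [x] becomes
   [r * w + (m0 - s0 ^+ 2 / S * u)]. *)
rewrite fubini_tonelli//; apply: eq_integral => u _.
have mGu : measurable_fun [set: R] (fun x => G (x, u)).
  by apply: measurableT_comp => //; exact: pair2_measurable.
rewrite (ge0_integral_affine _ _ (m0 - s0 ^+ 2 / S * u) r0)//.
have mw a b : measurable [set w : R | A (r * w + a, r * w + b)%R].
  rewrite -[X in measurable X]setTI.
  apply: (_ : measurable_fun [set: R] (fun w => (r * w + a, r * w + b)%R)) => //.
  by apply/measurable_fun_pairP; split => /=; exact: measurable_affine.
rewrite normal_prob_indic.
rewrite [RHS]muleC ge0_muleintegral; last 3 first.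
- by apply: measurableT_comp mGu _; exact: measurable_affine.
- by move=> w; exact: G0.
- by rewrite lee_fin ltW.
rewrite ge0_muleintegral; last 3 first.
- apply/measurable_EFinP; apply: measurable_funM; last exact: mpdf.
  by apply: measurable_indic; exact: mw.
- by move=> w; rewrite lee_fin mulr_ge0// normal_pdf_ge0.
- by rewrite lee_fin normal_pdf_ge0.
apply: eq_integral => w _; rewrite /G/= /F/= -!EFinM; congr EFin.
have -> : (S * u + (r * w + (m0 - s0 ^+ 2 / S * u) + (m1 - m0)) =
          r * w + (m1 + s1 ^+ 2 / S * u))%R.
  have -> : (s1 ^+ 2 = S ^+ 2 - s0 ^+ 2)%R by rewrite SE addrC addKr.
  by field.
rewrite /phi [RHS]mulrC -[RHS]mulrA -(normal_pdf_rotation m0 m1 s0 s1)// -/S -/r.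
have -> : \1_A (r * w + (m0 - s0 ^+ 2 / S * u), r * w + (m1 + s1 ^+ 2 / S * u))%R =
  \1_[set w | A (r * w + (m0 - s0 ^+ 2 / S * u), r * w + (m1 + s1 ^+ 2 / S * u))%R] w :> R.
  by rewrite !indicE; congr (nat_of_bool _)%:R; apply/idP/idP; rewrite !inE.
by rewrite [LHS]mulrA [LHS]mulrCA.
Qed.

End normal_rotation.

(** * The standard normal distribution function *)

Section integral_bounds.
Context {R : realType}.
Local Notation mu := (@lebesgue_measure R).
Local Open Scope ereal_scope.

(** A zero integral would make [f] vanish almost everywhere on [D]; as [f] vanishes nowhere, [D]
    would be null. *)
Lemma integral_gt0 (f : R -> R) (D : set R) : measurable D -> mu D != 0 ->
  measurable_fun [set: R] f -> (forall x, 0 < f x)%R ->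
  0 < \int[mu]_(x in D) (f x)%:E.
Proof.
move=> mD D0 mf f0; rewrite lt0e integral_ge0 ?andbT; last first.
  by move=> x _; rewrite lee_fin ltW.
apply: contra_neq D0 => intf0.
have mfD : measurable_fun D (EFin \o f) by apply/measurable_EFinP/measurable_funTS.
have : \int[mu]_(x in D) `|(EFin \o f) x| = 0.
  by rewrite -[RHS]intf0; apply: eq_integral => x _; rewrite /= ger0_norm// ltW.
move/(ae_eq_integral_abs mu mD mfD) => [N [mN N0 DN]].
apply/eqP; rewrite -measure_le0 -N0; apply: le_measure; rewrite ?inE//.
move=> x Dx; apply: DN => /= /(_ Dx)[] fx0.
by have := f0 x; rewrite fx0 ltxx.
Qed.

(** The increment is the integral over []x, y]] of a function with values in [0, 1]. This serves
    both [Phi] and the tail integrals of the closed form. *)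
Lemma integral_itvNyc_lipschitz (f : R -> R) (x y : R) : (x <= y)%R ->
  measurable_fun [set: R] f -> (forall u, 0 <= f u <= 1)%R ->
  \int[mu]_(u in `]-oo, x]) (f u)%:E <= \int[mu]_(u in `]-oo, y]) (f u)%:E <=
  \int[mu]_(u in `]-oo, x]) (f u)%:E + (y - x)%:E.
Proof.
move=> xy mf f01.
have mfD (D : set R) : measurable_fun D (EFin \o f) by apply/measurable_EFinP/measurable_funTS.
have f0 u : 0 <= (f u)%:E by rewrite lee_fin; case/andP: (f01 u).
rewrite (@itv_bndbnd_setU _ _ -oo%O (BRight x) (BRight y))//.
rewrite ge0_integral_setU//=; last 2 first.
- exact: mfD.
- apply/disj_setPS => u /= []; rewrite !in_itv/= => ux /andP[xu _].
  by move: (lt_le_trans xu ux); rewrite ltxx.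
apply/andP; split; first by rewrite leeDl// integral_ge0.
apply: leeD => //; apply: (@le_trans _ _ (\int[mu]_(u in `]x, y]) 1)).
  apply: ge0_le_integral => //=; first exact: mfD.
  by move=> u _; rewrite lee_fin; case/andP: (f01 u).
rewrite integral_cst//= mul1e lebesgue_measure_itv/= lte_fin -EFinB.
by case: ifPn => // _; rewrite lee_fin subr_ge0.
Qed.

End integral_bounds.

Section standard_normal.
Context {R : realType}.
Local Notation mu := (@lebesgue_measure R).
Implicit Types x y : R.

Lemma phi_gt0 x : 0 < phi x.
Proof.
by rewrite /phi normal_pdfE ?oner_neq0// mulr_gt0 ?expR_gt0// normal_peak_gt0 ?oner_neq0.
Qed.

Lemma phi_ge0 x : 0 <= phi x. Proof. exact/ltW/phi_gt0. Qed.

Lemma phi_le1 x : phi x <= 1.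
Proof.
apply: (le_trans (normal_pdf_ub 0 x (oner_neq0 R))).
rewrite /normal_peak invf_le1; last by rewrite sqrtr_gt0 expr1n mul1r mulrn_wgt0// pi_gt0.
rewrite -[leLHS]sqrtr1 ler_wsqrtr// expr1n mul1r.
by have := pi_ge2 R; lra.
Qed.

Lemma measurable_phi : measurable_fun [set: R] (@phi R).
Proof. exact: measurable_normal_pdf. Qed.

Lemma phiN x : phi (- x) = phi x.
Proof. by rewrite /phi !normal_pdfE ?oner_neq0// /normal_fun !subr0 sqrrN. Qed.

Lemma normal_prob_itvNyo (m s x : R) :
  normal_prob m s `]-oo, x[ = normal_prob m s `]-oo, x].
Proof.
rewrite /normal_prob integral_itv_bndo_bndc//.
by apply/measurable_EFinP/measurable_funTS; exact: measurable_normal_pdf.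
Qed.

Lemma EFin_Phi x : (Phi x)%:E = normal_prob 0 1 `]-oo, x].
Proof. by rewrite /Phi fineK// fin_num_measure. Qed.

Lemma Phi_lipschitz x y : x <= y -> Phi x <= Phi y <= Phi x + (y - x).
Proof.
move=> xy; rewrite -!lee_fin EFinD !EFin_Phi; apply: integral_itvNyc_lipschitz => //.
  exact: measurable_phi.
by move=> u; rewrite phi_ge0 phi_le1.
Qed.

Lemma normal_prob_itvcc x y : x <= y ->
  normal_prob 0 1 `[x, y] = (Phi y - Phi x)%:E.
Proof.
move=> xy; rewrite EFinB !EFin_Phi.
rewrite (@itv_bndbnd_setU _ _ -oo%O (BLeft x) (BRight y))// measureU//=; last first.
  apply/seteqP; split => // u /= []; rewrite !in_itv/= => ux /andP[xu _].
  by move: (lt_le_trans ux xu); rewrite ltxx.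
by rewrite normal_prob_itvNyo addeAC subee ?add0e// fin_num_measure.
Qed.

Lemma Phi_lt x y : x < y -> Phi x < Phi y.
Proof.
move=> xy; rewrite -subr_gt0 -lte_fin -normal_prob_itvcc ?ltW//.
apply: integral_gt0 => //=.
- by rewrite lebesgue_measure_itv/= lte_fin xy -EFinB eqe gt_eqF// subr_gt0.
- exact: measurable_normal_pdf.
- exact: phi_gt0.
Qed.

(** As [phi] is even, the left tail at [- x] has the mass of the right tail at [x], the complement
    of []-oo, x[]. *)
Lemma PhiN x : Phi (- x) = 1 - Phi x.
Proof.
apply: EFin_inj; rewrite EFinB.
transitivity (normal_prob 0 1 `[x, +oo[).
  rewrite EFin_Phi /normal_prob [RHS]ge0_integral_opp; last 3 first.
  - exact: measurable_itv.
  - by apply/measurable_EFinP; exact: measurable_normal_pdf.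
  - by move=> u; rewrite lee_fin normal_pdf_ge0.
  rewrite opp_preimage_itvbndy/=.
  by apply: eq_integral => u _; rewrite [normal_pdf _ _ (- u)]phiN.
rewrite -[X in (X - _)%E](@probability_setT _ _ _ (normal_prob (0 : R) 1)) EFin_Phi.
rewrite -set_itvNyy (@itv_bndbnd_setU _ _ -oo%O (BLeft x) +oo%O)// measureU//=; last first.
  apply/seteqP; split => // u /= []; rewrite !in_itv/= andbT => ux xu.
  by move: (lt_le_trans ux xu); rewrite ltxx.
by rewrite normal_prob_itvNyo addeAC subee ?add0e// fin_num_measure.
Qed.

Lemma Phi_ge0 x : 0 <= Phi x.
Proof. by rewrite -lee_fin EFin_Phi. Qed.

Lemma Phi_le1 x : Phi x <= 1.
Proof. by rewrite -lee_fin EFin_Phi probability_le1. Qed.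

Lemma measurable_Phi : measurable_fun [set: R] (@Phi R).
Proof.
by apply: nondecreasing_measurable => // x y xy; case/andP: (Phi_lipschitz _ _ xy).
Qed.

End standard_normal.

(** * Conditional coverage of the pretest estimator *)

Section conditional_coverage.
Context {R : realType}.
Local Notation mu := (@lebesgue_measure R).

(** Probability of coverage given [U = u]. The condition says that the pretest accepts. The first
    branch concerns the weighted average, whose error depends on [t] but not on [u]; the second
    concerns the unbiased observation alone, whose error depends on [u] but not on [t]. *)
Definition condcov (s0 s1 c t L u : R) : R :=
  let g := gam s0 s1 in
  if `|u + Num.sqrt (g / (1 + g)) * t| <= c
  then Phi (L - g / Num.sqrt (1 + g) * t) - Phi (- L - g / Num.sqrt (1 + g) * t)
  else Phi (L + Num.sqrt g * u) - Phi (- L + Num.sqrt g * u).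

Lemma measurable_tauPT (s0 s1 c : R) :
  measurable_fun [set: R * R] (fun z : R * R => tauPT s0 s1 c z.1 z.2).
Proof.
have md : measurable_fun [set: R * R] (fun z : R * R => z.2 - z.1).
  by apply: measurable_funB; [exact: measurable_snd|exact: measurable_fst].
apply: measurable_funD; first exact: measurable_fst.
apply: measurable_funM; first exact: measurable_funM.
apply: measurable_fun_ifT => //.
apply: measurable_fun_ler => //.
exact: measurableT_comp.
Qed.

Lemma measurable_PT_event (s0 s1 c tau B : R) :
  measurable [set x : R * R | `|tauPT s0 s1 c x.1 x.2 - tau| <= B].
Proof.
have mf : measurable_fun [set: R * R] (fun z : R * R => `|tauPT s0 s1 c z.1 z.2 - tau|).
  apply: measurableT_comp => //; apply: measurable_funB => //; exact: measurable_tauPT.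
rewrite (_ : mkset _ = [set: R * R] `&` (fun z : R * R => `|tauPT s0 s1 c z.1 z.2 - tau|) @^-1` `]-oo, B]); first exact: mf.
rewrite setTI.
by apply/seteqP; split => z /=; rewrite in_itv.
Qed.

Lemma normal_prob_ball (m L : R) : 0 <= L ->
  normal_prob 0 1 [set w : R | `|w - m| <= L] = (Phi (L + m) - Phi (- L + m))%:E.
Proof.
move=> L0; rewrite -normal_prob_itvcc; last by rewrite lerD2r ge0_cp.
congr normal_prob; apply/seteqP; split => w /=; rewrite in_itv/= ler_distl;
  by rewrite (addrC L) (addrC (- L)).
Qed.

Section gam_sqrt.
Variables s0 s1 : R.
Hypotheses (s00 : 0 < s0) (s10 : 0 < s1).
Let S := sig s0 s1.

Lemma sig_gt0 : 0 < S.
Proof. by rewrite sqrtr_gt0 addr_gt0// exprn_gt0. Qed.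

Lemma sqr_sig : S ^+ 2 = s0 ^+ 2 + s1 ^+ 2.
Proof. by rewrite sqr_sqrtr// ltW// addr_gt0// exprn_gt0. Qed.

Lemma sqrt_gam : Num.sqrt (gam s0 s1) = s0 / s1.
Proof. by rewrite /gam -expr_div_n sqrtr_sqr ger0_norm// ltW// divr_gt0. Qed.

Lemma add1_gam : 1 + gam s0 s1 = (S / s1) ^+ 2.
Proof. by rewrite expr_div_n sqr_sig /gam; field; rewrite gt_eqF. Qed.

Lemma sqrt_add1_gam : Num.sqrt (1 + gam s0 s1) = S / s1.
Proof. by rewrite add1_gam sqrtr_sqr ger0_norm// ltW// divr_gt0// sig_gt0. Qed.

Lemma sqrt_gam_add1 : Num.sqrt (gam s0 s1 / (1 + gam s0 s1)) = s0 / S.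
Proof.
rewrite add1_gam /gam (_ : _ / _ = (s0 / S) ^+ 2).
  by rewrite sqrtr_sqr ger0_norm// ltW// divr_gt0// sig_gt0.
by field; rewrite !gt_eqF// sig_gt0.
Qed.

End gam_sqrt.

(** With [u] fixed, the difference of the observations does not involve [w], so the outcome of the
    test is settled, and coverage asks that [w] lie within [L] of a known centre. *)
Lemma normal_prob_PT_section (s0 s1 c tau t L u : R) : 0 < s0 -> 0 < s1 -> 0 <= L ->
  let S := sig s0 s1 in
  normal_prob 0 1 [set w | `|tauPT s0 s1 c (s0 * s1 / S * w + (tau - s0 ^+ 2 / S * u))
      (s0 * s1 / S * w + (tau + t * s0 + s1 ^+ 2 / S * u)) - tau|
    <= L * (Num.sqrt (1 + gam s0 s1))^-1 * s0] = (condcov s0 s1 c t L u)%:E.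
Proof.
move=> s00 s10 L0 S; have S0 : 0 < S by exact: sig_gt0.
have SE : S ^+ 2 = s0 ^+ 2 + s1 ^+ 2 by exact: sqr_sig.
have [s0N s1N SN] : [/\ s0 != 0, s1 != 0 & S != 0] by rewrite !gt_eqF.
have r0 : 0 < s0 * s1 / S by rewrite divr_gt0// mulr_gt0.
have diffE w : s0 * s1 / S * w + (tau + t * s0 + s1 ^+ 2 / S * u) -
    (s0 * s1 / S * w + (tau - s0 ^+ 2 / S * u)) = S * (u + s0 / S * t).
  transitivity (t * s0 + (s0 ^+ 2 + s1 ^+ 2) / S * u); first by field.
  by rewrite -SE; field.
have testE : (`|S * (u + s0 / S * t)| <= S * c) = (`|u + s0 / S * t| <= c).
  by rewrite normrM gtr0_norm// ler_pM2l.
(* The unit of half-length, [s0] over the root of [1 + gam s0 s1], equals [s0 * s1 / S], the scale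
   of [w]. *)
have normE w m : (`|s0 * s1 / S * (w - m)| <= L * (S / s1)^-1 * s0) = (`|w - m| <= L).
  rewrite normrM gtr0_norm// (_ : L * _ * _ = s0 * s1 / S * L) ?ler_pM2l//.
  by field; rewrite SN s1N.
rewrite /condcov /tauPT sqrt_gam_add1// sqrt_add1_gam// sqrt_gam// -/S.
have [cu|cu] := leP (`|u + s0 / S * t|) c.
  rewrite -normal_prob_ball//; congr normal_prob; apply/funext => w /=; congr (is_true _).
  rewrite diffE testE cu mulr1 -normE; congr (`|_| <= _).
  by rewrite add1_gam// -/S /gam; field; rewrite SN s1N.
rewrite -normal_prob_ball//; congr normal_prob; apply/funext => w /=; congr (is_true _).
rewrite diffE testE [X in if X then _ else _]leNgt cu/= mulr0 addr0 -normE; congr (`|_| <= _).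
by field; rewrite SN s1N.
Qed.

Lemma covprobE (s0 s1 c tau t L : R) : 0 < s0 -> 0 < s1 -> 0 <= L ->
  covprob tau (t * s0) s0 s1 c L =
  (\int[mu]_u (condcov s0 s1 c t L u * phi u)%:E)%E.
Proof.
move=> s00 s10 L0; rewrite /covprob normal_product_rotation//; last first.
  exact: measurable_PT_event.
apply: eq_integral => u _; rewrite EFinM; congr (_ * _)%E.
exact: normal_prob_PT_section.
Qed.

End conditional_coverage.

(** * Bounds, symmetry and closed form of the conditional coverage *)

Section condcov_theory.
Context {R : realType}.
Local Notation mu := (@lebesgue_measure R).
Variables s0 s1 c : R.
Implicit Types t L u : R.

Local Notation H := (condcov s0 s1 c).

(** Each end moves by [L' - L] and [Phi] is 1-Lipschitz, whence the factor 2. *)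
Lemma Phi_interval_lt (L L' x y : R) : L < L' ->
  Phi (L + x) - Phi (- L + y) < Phi (L' + x) - Phi (- L' + y) <=
  Phi (L + x) - Phi (- L + y) + 2 * (L' - L).
Proof.
move=> LL'; apply/andP; split.
  by rewrite ltrB// Phi_lt// ltrD2r// ltrN2.
have /Phi_lipschitz/andP[_] : L + x <= L' + x by rewrite lerD2r ltW.
have /Phi_lipschitz/andP[_] : - L' + y <= - L + y by rewrite lerD2r lerN2 ltW.
lra.
Qed.

Lemma condcov_lt t u L L' : L < L' -> H t L u < H t L' u <= H t L u + 2 * (L' - L).
Proof. by move=> LL'; rewrite /condcov; case: ifPn => _; exact: Phi_interval_lt. Qed.

Lemma condcov0 t u : H t 0 u = 0.
Proof. by rewrite /condcov !oppr0 !subrr if_same. Qed.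

Lemma condcov_ge0 t u L : 0 <= L -> 0 <= H t L u.
Proof.
rewrite le_eqVlt => /predU1P[<-|L0]; first by rewrite condcov0.
by have /andP[/ltW] := condcov_lt t u _ _ L0; rewrite condcov0.
Qed.

Lemma condcov_le1 t u L : H t L u <= 1.
Proof.
by rewrite /condcov; case: ifPn => _; rewrite lerBlDr ler_wpDr ?Phi_ge0 ?Phi_le1.
Qed.

(** The test condition is even in [(t, u)], and [Phi (L + x) - Phi (- L + x)] is even in [x] by
    [PhiN]. *)
Lemma condcovN t u L : H (- t) L (- u) = H t L u.
Proof.
rewrite /condcov !mulrN -opprD normrN !opprK.
have e (x : R) : Phi (L + x) - Phi (- L + x) = Phi (L - x) - Phi (- L - x).
  have -> : L + x = - (- L - x) by rewrite opprB opprK addrC.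
  have -> : - L + x = - (L - x) by rewrite opprB addrC.
  by rewrite !PhiN; ring.
by case: ifP => _; [rewrite e|rewrite [RHS]e].
Qed.

Lemma measurable_Phi_affine (x y : R) :
  measurable_fun [set: R] (fun u => Phi (x + y * u)).
Proof.
apply: measurableT_comp; first exact: measurable_Phi.
by apply: measurable_funD => //; exact: measurable_funM.
Qed.

Lemma measurable_condcov t L : measurable_fun [set: R] (H t L).
Proof.
apply: measurable_fun_ifT => //.
- apply: measurable_fun_ler => //; apply: measurableT_comp => //.
  exact: measurable_funD.
- by apply: measurable_funB; exact: measurable_Phi_affine.
Qed.

Lemma measurable_condcov_phi t L :
  measurable_fun [set: R] (fun u => H t L u * phi u).
Proof.
by apply: measurable_funM; [exact: measurable_condcov|exact: measurable_phi].
Qed.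

(** Integrand of both tail integrals of the closed form. It is free of [t], so the bias moves only
    the endpoints of integration. *)
Definition tailcov L u : R :=
  (Phi (L + Num.sqrt (gam s0 s1) * u) - Phi (- L + Num.sqrt (gam s0 s1) * u)) * phi u.

Lemma measurable_tailcov L : measurable_fun [set: R] (tailcov L).
Proof.
apply: measurable_funM; last exact: measurable_phi.
by apply: measurable_funB; exact: measurable_Phi_affine.
Qed.

Lemma tailcov_ge0_le_phi L u : 0 <= L -> 0 <= tailcov L u <= phi u.
Proof.
move=> L0; have : - L + Num.sqrt (gam s0 s1) * u <= L + Num.sqrt (gam s0 s1) * u.
  by rewrite lerD2r ge0_cp.
move=> /Phi_lipschitz/andP[PLL _]; rewrite mulr_ge0 ?phi_ge0 ?subr_ge0//=.
by rewrite ler_piMl ?phi_ge0// lerBlDr ler_wpDr ?Phi_ge0 ?Phi_le1.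
Qed.

Hypotheses (s00 : 0 < s0) (s10 : 0 < s1).

(** Substitution of [- u] for [u]: [phi] is even and [condcovN] absorbs the change of sign of the
    bias. *)
Lemma covprobN tau Delta L : 0 <= L ->
  covprob tau Delta s0 s1 c L = covprob tau (- Delta) s0 s1 c L.
Proof.
move=> L0; have -> : Delta = Delta / s0 * s0 by rewrite divfK// gt_eqF.
rewrite -mulNr.
rewrite (covprobE _ _ _ _ _ _ s00 s10 L0).
rewrite (covprobE _ _ _ _ (- _) _ s00 s10 L0).
rewrite [LHS]ge0_integral_opp; last 3 first.
- exact: measurableT.
- by apply/measurable_EFinP; exact: measurable_condcov_phi.
- by move=> u; rewrite lee_fin mulr_ge0 ?condcov_ge0 ?phi_ge0.
rewrite preimage_setT; apply: eq_integral => u _.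
by rewrite phiN -[in RHS]condcovN opprK.
Qed.

(** The line is cut at the two critical values. In between the test accepts and [condcov] is the
    constant [K]; outside it rejects and the integrand is [tailcov]. *)
Lemma GPT_formulaE t L : 0 <= c -> 0 <= L ->
  (\int[mu]_u (H t L u * phi u)%:E)%E = GPT_formula s0 s1 c t L.
Proof.
move=> c0 L0; set a := Num.sqrt (gam s0 s1 / (1 + gam s0 s1)) * t.
set K := Phi (L - gam s0 s1 / Num.sqrt (1 + gam s0 s1) * t) -
  Phi (- L - gam s0 s1 / Num.sqrt (1 + gam s0 s1) * t).
have mH (D : set R) : measurable_fun D (fun u => (H t L u * phi u)%:E).
  by apply/measurable_funTS/measurable_EFinP; exact: measurable_condcov_phi.
have H0 u : (0 <= (H t L u * phi u)%:E)%E by rewrite lee_fin mulr_ge0 ?condcov_ge0 ?phi_ge0.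
have absE u : (`|u + a| <= c) = (- c - a <= u <= c - a).
  by rewrite ler_norml lerBlDr lerBrDr.
have mTD (D : set R) : measurable_fun D (fun u => (tailcov L u)%:E).
  by apply/measurable_funTS/measurable_EFinP; exact: measurable_tailcov.
have cc : - c - a <= c - a by rewrite lerD2r ge0_cp.
rewrite -set_itvNyy (@itv_bndbnd_setU _ _ -oo%O (BLeft (- c - a)) +oo%O)//.
rewrite ge0_integral_setU//=; last 2 first.
- exact: mH.
- apply/disj_setPS => u /= []; rewrite !in_itv/= andbT => ux xu.
  by move: (lt_le_trans ux xu); rewrite ltxx.
rewrite (@itv_bndbnd_setU _ _ (BLeft (- c - a)) (BRight (c - a)) +oo%O)//.
rewrite ge0_integral_setU//=; last 2 first.
- exact: mH.
- apply/disj_setPS => u /= []; rewrite !in_itv/= andbT => /andP[_ ux] xu.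
  by move: (le_lt_trans ux xu); rewrite ltxx.
rewrite addeCA addeA; congr (_ + _ + _)%E.
- transitivity (K%:E * normal_prob 0 1 `[(- c - a)%R, (c - a)%R])%E.
    rewrite /normal_prob -ge0_integralZl//=; last 3 first.
    + by apply/measurable_funTS/measurable_EFinP; exact: measurable_normal_pdf.
    + by move=> u _; rewrite lee_fin normal_pdf_ge0.
    (* [K] is nonnegative, being the value of [condcov] at [u = - a], where the test accepts because
       [c] is nonnegative. *)
    + have := condcov_ge0 t (- a) _ L0; rewrite /condcov -/a addNr normr0 c0.
      by rewrite lee_fin.
    by apply: eq_integral => u; rewrite inE/= in_itv/= -absE /condcov -/a => ->.
  by rewrite normal_prob_itvcc// -EFinM mulrC.
(* The cut leaves open tails while the formula has closed ones; the endpoints are null. *)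
- rewrite -[RHS]integral_itv_bndo_bndc; last exact: mTD.
  apply: eq_integral => u; rewrite inE/= in_itv/= => ua.
  by rewrite /condcov -/a absE leNgt ua.
- rewrite -[RHS]integral_itv_obnd_cbnd; last exact: mTD.
  apply: eq_integral => u; rewrite inE/= in_itv/= andbT => ua.
  by rewrite /condcov -/a absE andbC leNgt ua.
Qed.

End condcov_theory.

(** * Inverting a family of coverage curves *)

Section minimal_level.
Context {R : realType}.
Implicit Types (t L : R) (g : R -> R -> R).

(** Analytic core of (iii). The Lipschitz bound, uniform in [t], makes the infimum attained and
    forbids slack at it; strict growth gives uniqueness; evenness reduces [[-b, b]] to [[0, b]]. *)
Lemma minimal_level g (b v C : R) : 0 <= b -> 0 < C ->
  (forall t L, 0 <= L -> g (- t) L = g t L) ->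
  (forall t, g t 0 < v) ->
  (forall t L L', 0 <= L -> L < L' -> g t L < g t L' <= g t L + C * (L' - L)) ->
  (forall L, 0 <= L -> continuous (g^~ L)) ->
  (exists2 L, 0 <= L & forall t, `|t| <= b -> v <= g t L) ->
  let Lh := inf [set L | 0 <= L /\ forall t, `|t| <= b -> v <= g t L] in
  [/\ 0 <= Lh,
      exists2 t, 0 <= t <= b & g t Lh = v,
      forall L, 0 <= L -> (exists2 t, 0 <= t <= b & g t L = v) ->
        (forall t, 0 <= t <= b -> v <= g t L) -> L = Lh &
      forall L, 0 <= L -> (forall t, `|t| <= b -> v <= g t L) <-> Lh <= L].
Proof.
move=> b0 C0 gN g0 g_lt gc [L0 L00 gL0] Lh.
set S := [set L | 0 <= L /\ forall t, `|t| <= b -> v <= g t L] in Lh *.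
have S0 : S !=set0 by exists L0.
have lbS : lbound S 0 by move=> L [].
have hlS : has_lbound S by exists 0.
have Lh0 : 0 <= Lh by exact: lb_le_inf.
have g_homo t L L' : 0 <= L -> L <= L' -> g t L <= g t L'.
  move=> L0'; rewrite le_eqVlt => /predU1P[->//|LL'].
  by have /andP[/ltW] := g_lt t _ _ L0' LL'.
(* Some admissible level lies within [e / C] of [Lh], and descending from it to [Lh] costs at most
   [e]. *)
have SLh : S Lh.
  split=> // t tb; apply/ler_addgt0Pr => e e0.
  have [L [L00' SL] Le] := inf_adherent (divr_gt0 e0 C0) (conj S0 hlS).
  have LhL : Lh <= L by exact: ge_inf.
  apply: (le_trans (SL t tb)); move: LhL; rewrite le_eqVlt => /predU1P[<-|LhL].
    by rewrite lerDl ltW.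
  have /andP[_ /le_trans] := g_lt t _ _ Lh0 LhL; apply.
  by rewrite lerD2l mulrC -ler_pdivlMr// lerBlDl ltW.
have up L : 0 <= L -> (forall t, `|t| <= b -> v <= g t L) <-> Lh <= L.
  move=> L0'; split => [SL|LhL t tb]; first by apply: ge_inf.
  by apply: (le_trans (SLh.2 t tb)); exact: g_homo.
have pos L : (forall t, 0 <= t <= b -> v <= g t L) -> 0 <= L ->
    forall t, `|t| <= b -> v <= g t L.
  move=> vg L0' t; have [t0 tb|t0 tb] := ger0P t; first by apply: vg; rewrite t0.
  by rewrite -gN//; apply: vg; rewrite oppr_ge0 (ltW t0)/=.
split => //.
- have [t tb tmin] := EVT_min b0 (continuous_subspaceT (gc _ Lh0)).
  exists t; first by rewrite in_itv in tb.
  have tb' : `|t| <= b by move: tb; rewrite in_itv/= => /andP[/ger0_norm ->].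
  apply/eqP; rewrite eq_le (SLh.2 t tb') andbT leNgt; apply/negP => vg.
  (* If the minimum over [t] at [Lh] exceeded [v], lowering the level by [d] would cost every curve
     at most that excess, and [Lh] would not be the infimum. *)
  pose d := (g t Lh - v) / C.
  have d0 : 0 < d by rewrite divr_gt0// subr_gt0.
  have Lhp : 0 < Lh.
    rewrite lt_neqAle Lh0 andbT; apply/eqP => Lh00.
    by move: (g0 t); rewrite ltNge Lh00 (SLh.2 t tb').
  (* Truncation at 0, because the curves are controlled only at nonnegative levels. *)
  pose L := Num.max 0 (Lh - d).
  have LLh : L < Lh by rewrite gt_max Lhp gtrBl.
  have L0' : 0 <= L by rewrite le_max lexx.
  have : Lh <= L.
    apply/up => //; apply: pos => // s sb.
    have := tmin s; rewrite in_itv/= => /(_ sb) gs.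
    have /andP[_ gsL] := g_lt s _ _ L0' LLh.
    have : C * (Lh - L) <= g t Lh - v.
      rewrite mulrC -ler_pdivlMr// -/d lerBlDr -lerBlDl.
      by rewrite /L le_max lexx orbT.
    lra.
  by rewrite leNgt LLh.
- move=> L L0' [t tb gtL] vg; apply/eqP; rewrite eq_le; apply/andP; split.
    rewrite leNgt; apply/negP => LhL.
    have /andP[+ _] := g_lt t _ _ Lh0 LhL; rewrite gtL ltNge => /negP; apply.
    by apply: SLh.2; case/andP: tb => /ger0_norm ->.
  by apply/up => //; exact: pos.
Qed.

End minimal_level.

(** * Continuity of tail integrals in their endpoint *)

Section tail_integrals.
Context {R : realType}.
Local Notation mu := (@lebesgue_measure R).

Lemma lipschitz1_homo_continuous (f : R -> R) :
  (forall x y, x <= y -> f x <= f y <= f x + (y - x)) -> continuous f.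
Proof.
move=> fl x; apply/cvgrPdist_le => e e0; near=> y.
have : `|x - y| <= e by near: y; exact: (@cvgr_dist_le _ _ _ (nbhs x) _ id x (@cvg_id _ _) e e0).
apply: le_trans; have [xy|/ltW yx] := leP x y.
  rewrite distrC (distrC x) !ger0_norm ?subr_ge0//; case/andP: (fl _ _ xy) => //.
  by rewrite lerBlDl.
rewrite !ger0_norm ?subr_ge0//; case/andP: (fl _ _ yx) => //.
by rewrite lerBlDl.
Unshelve. all: by end_near. Qed.

Lemma fin_num_integral_le_phi (f : R -> R) (D : set R) : measurable D ->
  measurable_fun [set: R] f -> (forall u, 0 <= f u <= phi u) ->
  (\int[mu]_(u in D) (f u)%:E)%E \is a fin_num.
Proof.
move=> mD mf f01.
have f0 u : (0 <= (f u)%:E)%E by rewrite lee_fin; case/andP: (f01 u).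
rewrite ge0_fin_numE ?integral_ge0//.
apply: (@le_lt_trans _ _ (normal_prob 0 1 D)).
  apply: ge0_le_integral => //=.
  - by apply/measurable_EFinP/measurable_funTS.
  - by apply/measurable_EFinP/measurable_funTS; exact: measurable_normal_pdf.
  - by move=> u _; rewrite lee_fin; case/andP: (f01 u).
apply: (@le_lt_trans _ _ 1%E); last exact: ltry.
exact: (@probability_le1 _ _ _ (normal_prob (0 : R) 1)).
Qed.

Lemma continuous_integral_itvNyc (f : R -> R) :
  measurable_fun [set: R] f -> (forall u, 0 <= f u <= phi u) ->
  continuous (fun x => fine (\int[mu]_(u in `]-oo, x]) (f u)%:E)).
Proof.
move=> mf f01; apply: lipschitz1_homo_continuous => x y xy.
have fn z : (\int[mu]_(u in `]-oo, z]) (f u)%:E)%E \is a fin_num.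
  exact: fin_num_integral_le_phi.
rewrite -!lee_fin EFinD !fineK//; apply: integral_itvNyc_lipschitz => // u.
by case/andP: (f01 u) => -> /le_trans; apply; exact: phi_le1.
Qed.

(** Reflection turns the right tail into a left tail, and the bound by [phi] survives because [phi]
    is even. *)
Lemma continuous_integral_itvcy (f : R -> R) :
  measurable_fun [set: R] f -> (forall u, 0 <= f u <= phi u) ->
  continuous (fun x => fine (\int[mu]_(u in `[x, +oo[) (f u)%:E)).
Proof.
move=> mf f01.
have -> : (fun x => fine (\int[mu]_(u in `[x, +oo[) (f u)%:E)) =
    (fun x => fine (\int[mu]_(u in `]-oo, x]) (f (- u))%:E)) \o -%R.
  apply/funext => x /=; rewrite ge0_integral_opp; last 3 first.
  - exact: measurable_itv.
  - exact/measurable_EFinP.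
  - by move=> u; rewrite lee_fin; case/andP: (f01 u).
  by rewrite opp_preimage_itvbndy.
move=> x; apply: continuous_comp; first exact: opp_continuous.
apply: continuous_integral_itvNyc; first exact: measurableT_comp.
by move=> u; rewrite -phiN.
Qed.

End tail_integrals.

(** * Coverage as a function of the bias and the level *)

Section coverage.
Context {R : realType}.
Local Notation mu := (@lebesgue_measure R).
Variables s0 s1 c : R.
Hypotheses (s00 : 0 < s0) (s10 : 0 < s1) (c0 : 0 <= c).
Implicit Types t L u tau : R.

Local Notation H := (condcov s0 s1 c).

(** Real-valued, so that [minimal_level] applies. For [L >= 0] the integrand lies between 0 and
    [phi], so the integral is finite and [fine] loses nothing. *)
Definition coverage t L : R := fine (\int[mu]_u (H t L u * phi u)%:E)%E.

Lemma EFin_coverage t L : 0 <= L ->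
  (coverage t L)%:E = (\int[mu]_u (H t L u * phi u)%:E)%E.
Proof.
move=> L0; rewrite fineK//; apply: fin_num_integral_le_phi => //.
  exact: measurable_condcov_phi.
move=> u; rewrite mulr_ge0 ?condcov_ge0 ?phi_ge0//=.
by rewrite ler_piMl ?phi_ge0// condcov_le1.
Qed.

(* Unification would otherwise unfold the integral down to its definition. *)
#[local] Opaque coverage.

Lemma covprob_coverage tau t L : 0 <= L ->
  covprob tau (t * s0) s0 s1 c L = (coverage t L)%:E.
Proof. by move=> L0; rewrite (covprobE _ _ _ _ _ _ s00 s10 L0) EFin_coverage. Qed.

Lemma coverageN t L : 0 <= L -> coverage (- t) L = coverage t L.
Proof.
(* The value 0 for [tau] is arbitrary, as [coverage] does not involve it. *)
move=> L0; have := covprobN s0 s1 c s00 s10 0 (t * s0) _ L0.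
rewrite -mulNr (covprob_coverage 0 t _ L0) (covprob_coverage 0 (- t) _ L0).
by move=> e; rewrite (EFin_inj e).
Qed.

Lemma coverage0 t : coverage t 0 = 0.
Proof.
apply: EFin_inj; rewrite (EFin_coverage _ _ (lexx 0)) integral0_eq// => u _.
by rewrite condcov0 mul0r.
Qed.

(** The increment of [condcov] is positive and at most [2 * (L' - L)] at every [u], and it is
    integrated against a probability density. *)
Lemma coverage_lt t L L' : 0 <= L -> L < L' ->
  coverage t L < coverage t L' <= coverage t L + 2 * (L' - L).
Proof.
move=> L0 LL'; have L'0 : 0 <= L' by exact/ltW/(le_lt_trans L0 LL').
pose D u := H t L' u - H t L u.
have D0 u : 0 < D u by rewrite subr_gt0; case/andP: (condcov_lt s0 s1 c t u _ _ LL').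
have Dle u : D u <= 2 * (L' - L).
  by rewrite lerBlDl; case/andP: (condcov_lt s0 s1 c t u _ _ LL').
have mD : measurable_fun [set: R] (fun u => D u * phi u).
  apply: measurable_funM; last exact: measurable_phi.
  by apply: measurable_funB; exact: measurable_condcov.
have DE : (coverage t L')%:E = ((coverage t L)%:E + \int[mu]_u (D u * phi u)%:E)%E.
  rewrite [LHS](EFin_coverage t L' L'0).
  rewrite [X in (_ = X + _)%E](EFin_coverage t L L0).
  rewrite -ge0_integralD//=; last 4 first.
  - by move=> u _; rewrite lee_fin mulr_ge0 ?condcov_ge0 ?phi_ge0.
  - by apply/measurable_EFinP; exact: measurable_condcov_phi.
  - by move=> u _; rewrite lee_fin mulr_ge0 ?phi_ge0// ltW.
  - exact/measurable_EFinP.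
  by apply: eq_integral => u _; rewrite -EFinD -mulrDl /D addrC subrK.
have Igt0 : (0 < \int[mu]_u (D u * phi u)%:E)%E.
  apply: integral_gt0 => //; last by move=> u; rewrite mulr_gt0// phi_gt0.
  by rewrite -set_itvNyy lebesgue_measure_itv.
have Ile : (\int[mu]_u (D u * phi u)%:E <= (2 * (L' - L))%:E)%E.
  rewrite -[leRHS]mule1 -(integral_normal_pdf (0 : R) 1) ge0_muleintegral; last 3 first.
  - by apply/measurable_EFinP; exact: measurable_normal_pdf.
  - by move=> u; rewrite lee_fin normal_pdf_ge0.
  - by rewrite lee_fin mulr_ge0// subr_ge0 ltW.
  apply: ge0_le_integral => //=.
  - by move=> u _; rewrite lee_fin mulr_ge0 ?phi_ge0// ltW.
  - exact/measurable_EFinP.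
  - apply: emeasurable_funM => //.
    by apply/measurable_EFinP; exact: measurable_normal_pdf.
  - by move=> u _; rewrite -EFinM lee_fin ler_wpM2r// phi_ge0.
move: (\int[mu]_u _)%E DE Igt0 Ile => [r| |]// e.
rewrite lte_fin lee_fin => r0 rL; rewrite (EFin_inj (e : _ = (_ + r)%:E)).
by rewrite ltrDl r0 lerD2l.
Qed.

(** [condcov] may jump in [t] where the test switches, so continuity is read off the closed form,
    where [t] enters only through arguments of [Phi] and endpoints of integrals. *)
Lemma continuous_coverage L : 0 <= L -> continuous (coverage^~ L).
Proof.
move=> L0; set a := Num.sqrt (gam s0 s1 / (1 + gam s0 s1)).
set k := gam s0 s1 / Num.sqrt (1 + gam s0 s1).
have mT := measurable_tailcov s0 s1 L.
have T01 u := tailcov_ge0_le_phi s0 s1 L u L0.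
have -> : coverage^~ L = (fun t =>
    (Phi (c - a * t) - Phi (- c - a * t)) * (Phi (L - k * t) - Phi (- L - k * t)) +
    fine (\int[mu]_(u in `]-oo, (- c - a * t)%R]) (tailcov s0 s1 L u)%:E)%E +
    fine (\int[mu]_(u in `[(c - a * t)%R, +oo[) (tailcov s0 s1 L u)%:E)%E).
  apply/funext => t; apply: EFin_inj.
  rewrite (EFin_coverage t L L0) GPT_formulaE// /GPT_formula -/a -/k !EFinD !fineK//.
  - exact: fin_num_integral_le_phi.
  - exact: fin_num_integral_le_phi.
have cl (e b : R) : continuous (fun t => e - b * t).
  by move=> t; apply: cvgB; [exact: cvg_cst|exact: mulrl_continuous].
have cP (e b : R) : continuous (fun t => Phi (e - b * t)).
  move=> t; apply: (@continuous_comp _ _ _ (fun t => e - b * t) Phi); first exact: cl.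
  exact: (lipschitz1_homo_continuous _ Phi_lipschitz).
move=> t; apply: cvgD; first apply: cvgD.
- by apply: cvgM; apply: cvgB; exact: cP.
- apply: (@continuous_comp _ _ _ (fun t => - c - a * t)
    (fun x => fine (\int[mu]_(u in `]-oo, x]) (tailcov s0 s1 L u)%:E))); first exact: cl.
  exact: (continuous_integral_itvNyc _ mT T01).
- apply: (@continuous_comp _ _ _ (fun t => c - a * t)
    (fun x => fine (\int[mu]_(u in `[x, +oo[) (tailcov s0 s1 L u)%:E))); first exact: cl.
  exact: (continuous_integral_itvcy _ mT T01).
Qed.

(** Continuity from below along the intervals of integer radius, which exhaust the line. *)
Lemma normal_prob_itv_near1 (m s v : R) : v < 1 ->
  exists2 M, 0 <= M & (v%:E <= normal_prob m s `[(m - M)%R, (m + M)%R])%E.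
Proof.
move=> v1; pose F (n : nat) := `[m - n%:R, m + n%:R]%classic.
have bF : \bigcup_n F n = [set: R].
  apply/seteqP; split => // x _.
  exists (Num.truncn `|x - m|).+1 => //; rewrite /F/= in_itv/= -ler_distl.
  exact/ltW/truncnS_gt.
have := @nondecreasing_cvg_mu _ _ _ (normal_prob m s) F.
rewrite bF [X in _ --> X](_ : _ = 1%E); last exact: (@probability_setT _ _ _ (normal_prob m s)).
move=> /(_ (fun n => measurable_itv _) measurableT) cvF.
have hF : {homo F : n p / (n <= p)%N >-> (n <= p)%O}.
  move=> n p np; apply/subsetPset => x; rewrite /F/= !in_itv/= => /andP[? ?].
  have : n%:R <= p%:R :> R by rewrite ler_nat.
  by move=> ?; apply/andP; split; lra.
have [|N _ /(_ N (leqnn N))/ltW FN] := cvF hF [set y | (v%:E < y)%E].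
  by apply: open_nbhs_nbhs; split; [exact: open_ereal_gt_ereal|rewrite /= lte_fin].
by exists N%:R.
Qed.

(** The correction has weight at most 1 and acts only when the observations differ by at most
    [sig s0 s1 * c], so the estimator stays that close to the unbiased observation, whatever the
    bias. *)
Lemma coverage_near1 (v : R) : v < 1 ->
  exists2 L, 0 <= L & forall t, v <= coverage t L.
Proof.
move=> /(normal_prob_itv_near1 0 s0) [M M0 vM].
have S0 := sig_gt0 _ _ s00 s10.
have g0 : 0 <= gam s0 s1 by rewrite divr_ge0// sqr_ge0.
have w1 : gam s0 s1 / (1 + gam s0 s1) <= 1 by rewrite ler_pdivrMr ?ltr_wpDr// mul1r lerDr.
(* Chosen so that the half-length is [M + sig s0 s1 * c]. *)
pose L := (M + sig s0 s1 * c) * Num.sqrt (1 + gam s0 s1) / s0.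
have L0 : 0 <= L.
  by rewrite divr_ge0 ?(ltW s00)// mulr_ge0 ?sqrtr_ge0// addr_ge0// mulr_ge0// ltW.
exists L => // t; rewrite -lee_fin -(covprob_coverage 0 t L L0) (le_trans vM)//.
(* The coverage event contains a strip that restricts the first observation only; the second factor
   is a full mass of 1. *)
rewrite -[leLHS]mule1 -(@probability_setT _ _ _ (normal_prob (0 + t * s0) s1)).
rewrite -product_measure1E; [|exact: measurable_itv|exact: measurableT].
apply: le_measure; rewrite ?inE.
- by apply: measurableX; [exact: measurable_itv|exact: measurableT].
- exact: measurable_PT_event.
move=> [x y] /= [xM _].
have -> : L * (Num.sqrt (1 + gam s0 s1))^-1 * s0 = M + sig s0 s1 * c.
  by rewrite /L; field; rewrite !gt_eqF// sqrtr_gt0 ltr_wpDr.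
rewrite subr0 /tauPT (le_trans (ler_normD _ _))// lerD//.
  by move: xM; rewrite in_itv/= sub0r add0r -ler_norml.
case: ifPn => [xy|_]; last by rewrite mulr0 normr0 mulr_ge0// ltW.
rewrite mulr1 normrM ger0_norm; last by rewrite divr_ge0// addr_ge0.
by rewrite (le_trans _ xy)// ler_piMl.
Qed.

End coverage.

(** [PhiN] gives [Phi 0 = 1 / 2], which is less than [1 - alpha / 2]. *)
Lemma critical_value_gt0 {R : realType} (alpha c : R) : alpha < 1 ->
  Phi c = 1 - alpha / 2 -> 0 < c.
Proof.
move=> a1 Pc; rewrite ltNge; apply/negP => /Phi_lipschitz/andP[+ _].
by have := PhiN (0 : R); rewrite oppr0 Pc; lra.
Qed.

(** * Assembly of the three claims *)

Theorem theorem2 (R : realType) (s0 s1 alpha c : R) :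
  0 < s0 -> 0 < s1 -> 0 < alpha < 1 ->
  Phi c = 1 - alpha / 2 ->
  (* (i) symmetry in Delta *)
  (forall L : R, 0 < L -> forall tau Delta : R,
     covprob tau Delta s0 s1 c L = covprob tau (- Delta) s0 s1 c L) /\
  (* (ii) closed form of G_PT *)
  (forall tau t L : R, 0 <= L ->
     GPT tau s0 s1 c t L = GPT_formula s0 s1 c t L) /\
  (* (iii) characterization of hat L_PT *)
  (forall (tau b zeta : R), 0 <= b -> 0 < zeta < 1 ->
     let Lh := LPT tau s0 s1 c b zeta in
     (0 <= Lh /\ minG_eq tau s0 s1 c b Lh (1 - zeta) /\
      (forall L : R, 0 <= L -> minG_eq tau s0 s1 c b L (1 - zeta) -> L = Lh)) /\
     (forall L : R, 0 <= L ->
        ((forall Delta : R, `|Delta / s0| <= b ->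
            ((1 - zeta)%:E <= covprob tau Delta s0 s1 c L)%E) <-> Lh <= L))).
Proof.
move=> s00 s10 /andP[_ a1] Pc.
have c0 : 0 <= c by exact/ltW/(critical_value_gt0 _ _ a1 Pc).
split; [|split].
- by move=> L L0 tau Delta; apply: covprobN => //; exact: ltW.
- move=> tau t L L0; rewrite /GPT (covprobE _ _ _ _ _ _ s00 s10 L0).
  exact: GPT_formulaE.
move=> tau b zeta b0 /andP[z0 z1] Lh.
have covE t L : 0 <= L -> GPT tau s0 s1 c t L = (coverage s0 s1 c t L)%:E.
  by move=> L0; exact: covprob_coverage.
(* Passage from biases [Delta] to scaled biases [t = Delta / s0]. *)
have covT L : 0 <= L ->
    (forall Delta, `|Delta / s0| <= b -> ((1 - zeta)%:E <= covprob tau Delta s0 s1 c L)%E) <->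
    (forall t, `|t| <= b -> 1 - zeta <= coverage s0 s1 c t L).
  move=> L0; split => [cov t tb|cov Delta Db].
    rewrite -lee_fin -(covE t L L0); apply: cov.
    by rewrite mulfK// gt_eqF.
  have := cov _ Db; rewrite -lee_fin -(covE _ L L0) /GPT divfK// gt_eqF//.
(* The Lipschitz constant 2 is that of [coverage_lt]. *)
have [] := minimal_level (coverage s0 s1 c) b (1 - zeta) 2 b0.
- by [].
- by move=> t L L0; exact: coverageN.
- by move=> t; rewrite coverage0// subr_gt0.
- by move=> t L L' L0 LL'; exact: coverage_lt.
- by move=> L L0; exact: continuous_coverage.
- have [|L L0 vL] := coverage_near1 s0 s1 c s00 s10 c0 (1 - zeta); first by rewrite ltrBlDr ltrDl.
  by exists L.
(* A lower bound on the extended infimum over biases is a lower bound on each coverage probability,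
   so the two sets of levels coincide. *)
have <- : Lh = inf [set L | 0 <= L /\ forall t, `|t| <= b -> 1 - zeta <= coverage s0 s1 c t L].
  congr inf; apply/seteqP; split => L /= [L0].
    move=> /ereal_infP cov; split=> //; apply/(covT L L0) => Delta Db.
    by apply: cov; exists Delta.
  by move=> /(covT L L0) cov; split=> //; apply/ereal_infP => _ [Delta Db <-]; exact: cov.
move=> Lh0 [t tb covt] uniq_Lh Lh_le.
split; last by move=> L L0; apply: (iff_trans (covT L L0)); exact: Lh_le.
split=> //; split.
  split; first by exists t => //; rewrite covE// covt.
  move=> s /andP[s0b sb]; rewrite covE// lee_fin; apply: (Lh_le _ Lh0).2 => //.
  by rewrite ger0_norm.
move=> L L0 [[s sb covs] cov]; apply: (uniq_Lh _ L0).
  exists s; first exact: sb.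
  by rewrite (covE s L L0) in covs; exact: EFin_inj covs.
by move=> r rb; rewrite -lee_fin -(covE r L L0); exact: cov.
Qed.
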